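(* Let $\mathcal D\subset\mathbb R^2$ be a smooth convex domain of area $1$ and $\mathcal D_n=\sqrt n\,\mathcal D$. Let $\mathbf X_n=\{X_1,\dots,X_n\}$ be a collection of $n$ independent uniformly random points in $\mathcal D_n$. For $z\in\mathbf X_n$ and $q\in\mathcal D_n$, let $M(z,q)$ be the maximum number of neighbourhoods needed to compute every step of the cone walk from $z$ to $q$ on $\mathrm{DT}(\mathbf X_n)$. Then for every $\epsilon>0$, $$\mathbb P\Big(\exists z\in\mathbf X_n,\ q\in\mathcal D_n:\ M(z,q)>\log^{3+\epsilon}n\Big)\le\frac1n .$$ In particular, as $n\to\infty$, $\mathbb E\big[\sup_{z\in\mathbf X_n,\,q\in\mathcal D_n}M(z,q)\big]=O(\log^{3+\epsilon}n)$ for every $\epsilon>0$.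
   Context: $\log^a n$ means $(\log n)^a$; $\|xy\|$ is Euclidean distance; $\mathrm{DT}(\mathbf X)$ is the Delaunay triangulation of a finite planar set $\mathbf X$ of sites. For distinct points $z,q\in\mathbb R^2$ and $r\ge0$, $\mathrm{Disc}(z,q,r)$ is the closed disc one of whose diameters is the segment from $z$ to the point at distance $2r$ from $z$ on the ray from $z$ through $q$; $\mathrm{Cone}(z,q,r)$ is the part of $\mathrm{Disc}(z,q,r)$ lying in the closed cone with apex $z$, axis the ray $zq$, and half-angle $\pi/8$. Cone walk from a site $z\in\mathbf X$ to a destination $q$: put $Z_0=z$. Given the current site $Z_i\neq q$, grow $r$ from $0$ until either $\mathrm{Cone}(Z_i,q,r)$ contains a site other than $Z_i$, or $\mathrm{Disc}(Z_i,q,r)$ contains $q$ (i.e. $r=\|Z_iq\|/2$). Let $R_i$ be the value of $r$ at which this happens and $D_i=\mathrm{Disc}(Z_i,q,R_i)$ (the search disc of step $i$). If $q$ is reached, the walk terminates with this step; otherwise the site found is the stopper $Z_{i+1}$ and the walk continues from it. Ties are broken by an arbitrary fixed rule. The vertices accessed in step $i$ are the sites contained in $D_i$ together with their neighbours in $\mathrm{DT}(\mathbf X)$. $N_d(v)$ denotes the set of vertices within $d$ hops of $v$ in $\mathrm{DT}(\mathbf X)$. The number of neighbourhoods needed in step $i$ is the least $d$ such that all vertices accessed in step $i$ lie in $N_d(Z_i)\cup\{Z_i\}$, and $M(z,q)$ is the maximum of this number over all steps $i$ of the walk from $z$ to $q$.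
   Formalization: The probability bound 1/n is proved for all sufficiently large n (the threshold may depend on the domain, the tie rule and epsilon), since for n = 2 it fails: with z = X_1, q = X_2 one has M(z,q) >= 1 > (log 2)^(3+epsilon) almost surely. *)

(* Defs.v *)
From HB Require Import structures.
From mathcomp Require Import all_boot all_order all_algebra.
From mathcomp Require Import all_classical all_reals all_analysis.
From mathcomp Require Import measurable_realfun.

Set Implicit Arguments.
Unset Strict Implicit.
Unset Printing Implicit Defensive.

Import Order.TTheory GRing.Theory Num.Theory.
Import numFieldNormedType.Exports.

Local Open Scope classical_set_scope.
Local Open Scope ring_scope.

(* The norm carried by R * R is the sup norm, whence the explicit Euclidean
   structure below. Topology and Borel sets are the product ones. *)
Definition plane (R : realType) : Type := (R * R)%type.

Definition dot (R : realType) (u v : plane R) : R := u.1 * v.1 + u.2 * v.2.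

Definition enorm (R : realType) (u : plane R) : R := Num.sqrt (dot u u).

Definition vect (R : realType) (p q : plane R) : plane R :=
  (q.1 - p.1, q.2 - p.2).

Definition edist (R : realType) (p q : plane R) : R := enorm (vect p q).

Definition dilate (R : realType) (c : R) (D : set (R * R)) : set (R * R) :=
  [set (c * p.1, c * p.2) | p in D].

Definition area (R : realType) : set (R * R) -> \bar R :=
  (@lebesgue_measure R \x @lebesgue_measure R)%E.

Definition smooth_function (R : realType) (f : R -> R) : Prop :=
  forall (k : nat) (t : R), derivable (derive1n k f) t 1.

(* (x, y) is a regular C^oo simple closed curve, parametrized with period 1. *)
Definition smooth_simple_closed_curve (R : realType) (x y : R -> R) : Prop :=
  [/\ smooth_function x, smooth_function y,
      (forall t, (derive1 x t, derive1 y t) <> (0, 0)) &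
      (forall s t, ((x s, y s) = (x t, y t)) <->
                   exists k : int, t - s = k%:~R)].

(* D may contain all, part or none of its boundary, so both the open and the
   closed convex domains are covered; D is bounded as soon as its area is
   finite. *)
Definition smooth_convex_domain (R : realType) (D : set (R * R)) : Prop :=
  [/\ measurable D,
      @convex_set R (R^o * R^o)%type D &
      exists x y : R -> R, smooth_simple_closed_curve x y /\
        closure D `\` interior D = range (fun t => (x t, y t))].

Section ConeWalk.
Variable R : realType.
Implicit Types (S : set (plane R)) (p q s v w z : plane R).

(* Centre of the disc: the point at distance r from z on the ray zq, which is
   the midpoint of the prescribed diameter. *)
Definition disc_center z q (r : R) : plane R :=
  (z.1 + r * ((vect z q).1 / edist z q), z.2 + r * ((vect z q).2 / edist z q)).

Definition Disc z q (r : R) : set (plane R) :=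
  [set p | edist (disc_center z q r) p <= r].

(* The condition on the dot product says that the angle between zp and zq is at
   most pi / 8. *)
Definition Cone z q (r : R) : set (plane R) :=
  Disc z q r `&`
  [set p | cos (pi / 8) * (edist z p * edist z q) <= dot (vect z p) (vect z q)].

(* Edges of the Delaunay triangulation, by the empty circle property: there is
   a circle through v and w with no site inside. When four or more sites lie on
   an empty circle all diagonals are included; random sites are almost surely
   not in such a position. *)
Definition DT_edge S v w : Prop :=
  [/\ S v, S w, v <> w &
      exists c, edist c v = edist c w /\ forall s, S s -> edist c v <= edist c s].

Fixpoint neighbourhood S (d : nat) v : set (plane R) :=
  match d with
  | 0 => [set v]
  | d'.+1 => neighbourhood S d' v `|`
             [set w | exists2 u, neighbourhood S d' v u & DT_edge S u w]
  end.

Definition step_radius S z q : R :=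
  inf [set r : R | 0 <= r /\
    ((exists s, [/\ S s, s <> z & Cone z q r s]) \/ Disc z q r q)].

Definition search_disc S z q : set (plane R) := Disc z q (step_radius S z q).

(* On a tie between q and a site, q counts as reached. *)
Definition reaches S z q : Prop := search_disc S z q q.

Definition stoppers S z q : set (plane R) :=
  [set s | [/\ S s, s <> z & Cone z q (step_radius S z q) s]].

(* cone_walk S next z q i p : the walk from z to q performs at least i
   nonfinal steps, and p is its i-th site Z_i. *)
Inductive cone_walk S (next : plane R -> plane R -> plane R) z q :
    nat -> plane R -> Prop :=
| cone_walk_start : cone_walk S next z q 0 z
| cone_walk_step i p : cone_walk S next z q i p -> p <> q ->
    ~ reaches S p q -> cone_walk S next z q i.+1 (next p q).

Definition accessed S z q : set (plane R) :=
  [set v | S v /\ search_disc S z q v] `|`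
  [set v | exists2 s, S s /\ search_disc S z q s & DT_edge S s v].

(* +oo if no d is suitable. *)
Definition neighbourhoods_needed S z q : \bar R :=
  ereal_inf [set d%:R%:E | d in
    [set d : nat | accessed S z q `<=` neighbourhood S d z `|` [set z]]].

(* The element 0 only matters when z = q, in which case there is no step. *)
Definition max_neighbourhoods S next z q : \bar R :=
  ereal_sup (0%E |` [set m | exists i p,
    [/\ cone_walk S next z q i p, p <> q & m = neighbourhoods_needed S p q]]).

End ConeWalk.

(* A rule may depend on n, on the labelled configuration of sites, on the
   current site and on the destination. *)
Definition tie_rule (R : realType) : Type :=
  forall n : nat, ('I_n -> plane R) -> plane R -> plane R -> plane R.

Definition breaks_ties (R : realType) (rule : tie_rule R) : Prop :=
  forall (n : nat) (x : 'I_n -> plane R) (z q : plane R),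
    stoppers (range x) z q !=set0 -> stoppers (range x) z q (rule n x z q).

Section Probability.
Local Open Scope ereal_scope.
Context (d : measure_display) (T : measurableType d) (R : realType).
Variable P : probability T R.

Definition uniform_on (D : set (R * R)) (X : {RV P >-> (R * R)%type}) : Prop :=
  forall A : set (R * R), measurable A ->
    distribution P X A = area (A `&` D) / area D.

Definition mutually_independent (n : nat) (X : 'I_n -> {RV P >-> (R * R)%type}) :
    Prop :=
  forall A : 'I_n -> set (R * R), (forall i, measurable (A i)) ->
    P (\bigcap_i (X i @^-1` A i)) = \prod_(i < n) P (X i @^-1` A i).

(* The functionals below quantify over uncountably many destinations and over
   arbitrary tie-breaking rules, so that measurability is not granted. Upper
   expectations, like the outer measure mu_ext P, coincide with the usual notion
   on measurable arguments. *)
Definition upper_expectation (f : T -> \bar R) : \bar R :=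
  ereal_inf [set \int[P]_w g w | g in
    [set g : T -> \bar R | measurable_fun setT g /\ forall w, f w <= g w]].

End Probability.

(* Main.v *)
Require Import Defs.
From HB Require Import structures.
From mathcomp Require Import all_boot all_order all_algebra.
From mathcomp Require Import all_classical all_reals all_analysis.
From mathcomp Require Import measurable_realfun.
From mathcomp Require Import ring lra.

Import Order.TTheory GRing.Theory Num.Theory.
Import numFieldNormedType.Exports.

Local Open Scope classical_set_scope.
Local Open Scope ring_scope.

Local Notation edist := Defs.edist.

Set Implicit Arguments.
Unset Strict Implicit.
Unset Printing Implicit Defensive.
(** Whatever the walk, one step started at a site [z] accesses only sites of
    the search disc, which are within [2 * R] of [z], and their neighbours. The
    number of hops is controlled by a greedy descent. Let [a] be a site other
    than [z], and let a disc through [a] grow with its centre moving from [a]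
    to [z]. The first site met on its boundary is a Delaunay neighbour of [a]
    and is strictly closer to [z] ([DT_edge_towards]). Iterating this,
    every site [v] is reached from [z] in at most as many hops as there are
    sites closer to [z] than [v]. Hence the number of neighbourhoods needed in
    a step is at most the number of sites within [2 * R] of [z]
    ([neighbourhoods_needed_le]); in particular it never exceeds [n].

    It remains to see that, outside an event of probability at most [1 / n],
    every step radius is [O(sqrt (ln n))] and every disc of such a radius
    contains at most [ln n ^ 3] sites. Both follow from a union bound over the
    [n ^ 2] squares of a lattice of mesh [s] of order [sqrt (ln n)]:
    - a lattice square inside the domain receives on average at least [4 ln n]
      sites, and is empty with probability at most [n ^ -4];
    - a larger concentric square, of side still [O(sqrt (ln n))], receives on
      average [O(ln n)] sites, and by a Poisson tail estimate it contains more
      than [ln n ^ 3] sites with probability at most [n ^ -4].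

    Near the boundary the cone may leave the domain, but by convexity it cannot
    do so entirely: the domain contains the triangle spanned by [z], [q] and a
    disc of radius of order [sqrt n], whose angles at [z] and [q] are bounded
    below. This leaves room, in the part of a cone of size [O(sqrt (ln n))]
    lying in the domain, for a lattice square ([cone_room]), and this square
    contains a site, so the cone has stopped growing ([sites_within_step]).

    The bound in probability follows, and so does the one in mean, since [n]
    bounds the number of neighbourhoods on the exceptional event. *)

(** * Euclidean geometry of search discs *)

Section Plane.
Variable R : realType.
Implicit Types p q u v w z : plane R.

Lemma dot_ge0 u : 0 <= dot u u.
Proof. by rewrite /dot; nra. Qed.

Lemma enorm_ge0 u : 0 <= enorm u.
Proof. exact: sqrtr_ge0. Qed.

Lemma enorm_sqr u : enorm u ^+ 2 = dot u u.
Proof. by rewrite /enorm sqr_sqrtr ?dot_ge0. Qed.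

Lemma edist_ge0 p q : 0 <= edist p q.
Proof. exact: enorm_ge0. Qed.

Lemma edist_sqr p q : edist p q ^+ 2 = (q.1 - p.1) ^+ 2 + (q.2 - p.2) ^+ 2.
Proof. by rewrite /edist enorm_sqr /dot /vect /= !expr2. Qed.

Lemma edist_le p q p' q' :
  (edist p q <= edist p' q') = (edist p q ^+ 2 <= edist p' q' ^+ 2).
Proof. by rewrite ler_pXn2r // nnegrE edist_ge0. Qed.

Lemma edist_lt p q p' q' :
  (edist p q < edist p' q') = (edist p q ^+ 2 < edist p' q' ^+ 2).
Proof. by rewrite ltr_pXn2r // nnegrE edist_ge0. Qed.

Lemma edist_ler p q (r : R) : 0 <= r -> (edist p q <= r) = (edist p q ^+ 2 <= r ^+ 2).
Proof. by move=> r0; rewrite ler_pXn2r // nnegrE edist_ge0. Qed.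

Lemma edistxx p : edist p p = 0.
Proof. by apply/eqP; rewrite -sqrf_eq0 edist_sqr !subrr expr0n addr0. Qed.

Lemma edist_gt0 p q : p <> q -> 0 < edist p q.
Proof.
move=> pq; rewrite lt_neqAle edist_ge0 andbT; apply/negP => /eqP e0; apply: pq.
have /eqP := edist_sqr p q.
rewrite -e0 expr0n eq_sym paddr_eq0 ?sqr_ge0// !sqrf_eq0 !subr_eq0.
by case: p q {e0} => [a b] [c d] /= /andP[/eqP -> /eqP ->].
Qed.

Lemma dot_le_enorm u v : dot u v <= enorm u * enorm v.
Proof.
have h : dot u v ^+ 2 <= (enorm u * enorm v) ^+ 2.
  rewrite exprMn !enorm_sqr /dot -subr_ge0.
  by rewrite (_ : _ - _ = (u.1 * v.2 - u.2 * v.1) ^+ 2) ?sqr_ge0//; ring.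
have [d0|d0] := leP (dot u v) 0.
  by rewrite (le_trans d0)// mulr_ge0 ?enorm_ge0.
by move: h; rewrite ler_pXn2r // nnegrE ?mulr_ge0 ?enorm_ge0// ltW.
Qed.

(** Squaring the defining inequality cancels the terms in [r ^ 2]: for a fixed
    point, membership is a linear condition on the radius. *)
Lemma in_DiscE z q (r : R) p : z <> q -> 0 <= r ->
  Disc z q r p <-> edist z p ^+ 2 * edist z q <= 2 * r * dot (vect z p) (vect z q).
Proof.
move=> zq r0; rewrite /Disc /= edist_ler // edist_sqr.
have L0 := edist_gt0 zq; have := edist_sqr z q.
rewrite [edist z p ^+ 2]edist_sqr /disc_center /dot /vect /=.
move: L0; set L := edist z q => L0 LE.
set a := p.1 - z.1; set b := p.2 - z.2; set c := q.1 - z.1; set d := q.2 - z.2.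
have LE' : (c / L) ^+ 2 + (d / L) ^+ 2 = 1.
  have L2 : L ^+ 2 != 0 by rewrite sqrf_eq0 gt_eqF.
  by rewrite !expr_div_n -mulrDl /c /d  -LE mulfV.
rewrite (_ : _ + _ = a ^+ 2 + b ^+ 2 - 2 * r * (a * (c / L) + b * (d / L)) + r ^+ 2 *
   ((c / L) ^+ 2 + (d / L) ^+ 2)); last by rewrite /a /b; ring.
rewrite LE' mulr1 gerDr subr_le0.
rewrite (_ : a * (c / L) + b * (d / L) = (a * c + b * d) / L); last by ring.
by rewrite mulrA ler_pdivlMr.
Qed.

Lemma Disc_edist_le z q (r : R) p : z <> q -> 0 <= r ->
  Disc z q r p -> edist z p <= 2 * r.
Proof.
move=> zq r0 /in_DiscE - /(_ zq r0) h.
have L0 := edist_gt0 zq.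
have [->|zp] := pselect (z = p); first by rewrite edistxx mulr_ge0.
have l0 := edist_gt0 zp.
have := dot_le_enorm (vect z p) (vect z q); rewrite -/(edist _ _) -/(edist _ _) => h2.
have : edist z p ^+ 2 * edist z q <= 2 * r * (edist z p * edist z q).
  by apply: (le_trans h); apply: ler_wpM2l => //; rewrite mulr_ge0.
rewrite expr2 -[_ * _ * edist z q]mulrA ler_pM2r //; exact: mulr_gt0.
Qed.

End Plane.

(** * Descending towards a site along Delaunay edges *)

Section Hops.
Variables (R : realType) (n : nat) (x : 'I_n -> plane R).
Let S : set (plane R) := range x.

Lemma DT_edge_sym v w : DT_edge S v w -> DT_edge S w v.
Proof.
case=> Sv Sw vw [c [e h]]; split=> //; first by move=> /esym.
by exists c; split=> // s Ss; rewrite -e; exact: h.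
Qed.

(** The disc through [a] centred at [a + t (z - a)] contains [x i] exactly when
    [t] is at least [t i] below, provided [x i] is strictly closer to [z] than
    [a]. At the least such [t i] the disc has no site inside: such a site would
    be strictly closer to [z] than [a], because the disc is contained in the one
    about [z] through [a], and it would have been met earlier. *)
Lemma DT_edge_towards z a : S z -> S a -> a <> z ->
  exists2 s, DT_edge S a s & edist z s < edist z a.
Proof.
move=> [iz _ xz] Sa az.
pose m i := dot (vect a z) (vect a (x i)).
pose t i := edist a (x i) ^+ 2 / (2 * m i).
pose cand i := edist z (x i) < edist z a.
have candE i : cand i = (edist a (x i) ^+ 2 < 2 * m i).
  rewrite /cand edist_lt /m /dot /vect /= !edist_sqr; apply/idP/idP; lra.
have dE c i : edist (a.1 + c * (z.1 - a.1), a.2 + c * (z.2 - a.2)) (x i) ^+ 2 -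
    edist (a.1 + c * (z.1 - a.1), a.2 + c * (z.2 - a.2)) a ^+ 2 =
    edist a (x i) ^+ 2 - c * (2 * m i).
  by rewrite !edist_sqr /m /dot /vect /=; ring.
have cz : cand iz by rewrite /cand xz edistxx; apply: edist_gt0 => /esym.
case: (arg_minP t cz) => j cj jmin.
have mj : 0 < 2 * m j by move: cj; rewrite candE; apply: le_lt_trans; exact: sqr_ge0.
have tE : t j * (2 * m j) = edist a (x j) ^+ 2 by rewrite /t divfK // gt_eqF.
have t0 : 0 <= t j by rewrite /t divr_ge0 ?sqr_ge0// ltW.
have t1 : t j <= 1.
  by rewrite /t ler_pdivrMr // mul1r ltW // -candE.
exists (x j) => //.
split=> //; first by exists j.
  by move=> e; move: cj; rewrite /cand -e ltxx.
exists (a.1 + t j * (z.1 - a.1), a.2 + t j * (z.2 - a.2)); split.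
  apply/eqP; rewrite -(eqrXn2 (n := 2)) ?edist_ge0//; apply/eqP.
  by apply/esym/eqP; rewrite -subr_eq0 dE tE subrr.
move=> _ [i _ <-]; rewrite edist_le -subr_ge0 dE subr_ge0.
have [ci|] := boolP (cand i).
  have mi : 0 < 2 * m i by move: ci; rewrite candE; apply: le_lt_trans; exact: sqr_ge0.
  by rewrite -ler_pdivlMr //; exact: jmin.
rewrite candE -leNgt => h; have [mi|mi] := leP 0 (2 * m i).
  by apply: le_trans h; rewrite ler_piMl.
by apply: le_trans (sqr_ge0 _); rewrite mulr_ge0_le0 // ltW.
Qed.

Definition nearer z v : nat := #|[pred i | edist z (x i) < edist z v]|.
Definition sites_within z (r : R) : nat := #|[pred i | edist z (x i) <= r]|.

Lemma neighbourhood_mono d d' v : (d <= d')%N ->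
  neighbourhood S d v `<=` neighbourhood S d' v.
Proof.
move=> /subnKC <-; elim: (d' - d)%N => [|k IH]; first by rewrite addn0.
by rewrite addnS => p /IH; left.
Qed.

Lemma nearer_lt z u v : S u -> edist z u < edist z v -> (nearer z u < nearer z v)%N.
Proof.
move=> [i _ xi] uv; apply: proper_card; apply/properP; split.
  by apply/fintype.subsetP => j; rewrite !inE => /lt_trans; apply.
by exists i; rewrite !inE xi // ltxx.
Qed.

Lemma nearer_within z u (r : R) : S u -> edist z u <= r ->
  (nearer z u < sites_within z r)%N.
Proof.
move=> [i _ xi] uv; apply: proper_card; apply/properP; split.
  by apply/fintype.subsetP => j; rewrite !inE => /ltW /le_trans; apply.
by exists i; rewrite !inE xi // ltxx.
Qed.

(** Each edge of the greedy descent from [v] to [z] decreases [nearer z]. *)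
Lemma neighbourhood_nearer z v : S z -> S v -> neighbourhood S (nearer z v) z v.
Proof.
move=> Sz; have [k] := ubnP (nearer z v); elim: k v => // k IH v vk Sv.
have [->|vz] := pselect (v = z).
  by apply: (@neighbourhood_mono 0).
have [s e sv] := DT_edge_towards Sz Sv vz; have Ss : S s by case: e.
have lt := nearer_lt Ss sv.
apply: (neighbourhood_mono lt) => /=; right; exists s; last exact: DT_edge_sym.
by apply: IH => //; apply: leq_trans lt _.
Qed.

(** A neighbour [v] of a site [s] of the search disc costs one more hop than
    [s]; this hop is paid for by [s] itself, which [nearer z s] does not count. *)
Lemma accessed_neighbourhood z q : S z -> z <> q -> 0 <= step_radius S z q ->
  accessed S z q `<=` neighbourhood S (sites_within z (2 * step_radius S z q)) z.
Proof.
move=> Sz zq r0 v [[Sv Dv]|[s [Ss Ds] e]].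
  apply: (@neighbourhood_mono (nearer z v)); last exact: neighbourhood_nearer.
  by apply/ltnW/nearer_within => //; exact: Disc_edist_le Dv.
apply: (@neighbourhood_mono (nearer z s).+1).
  by apply/nearer_within => //; exact: Disc_edist_le Ds.
by right; exists s => //; exact: neighbourhood_nearer.
Qed.

Lemma neighbourhoods_needed_le z q : S z -> z <> q -> 0 <= step_radius S z q ->
  (neighbourhoods_needed S z q <=
   (sites_within z (2 * step_radius S z q))%:R%:E)%E.
Proof.
move=> Sz zq r0; apply: ereal_inf_lbound; eexists; last reflexivity.
by move=> v /= /(accessed_neighbourhood Sz zq r0); left.
Qed.

End Hops.

(** * Step radii are attained *)

Section StepRadius.
Variables (R : realType) (n : nat) (x : 'I_n -> plane R).
Let S : set (plane R) := range x.
Variables (z q : plane R) (zq : z <> q).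

Let stop : set R := [set r : R | 0 <= r /\
  ((exists s, [/\ S s, s <> z & Cone z q r s]) \/ Disc z q r q)].

Let stop_half : stop (edist z q / 2).
Proof.
have L0 := edist_gt0 zq.
have L2 : 0 <= edist z q / 2 by rewrite divr_ge0 ?ltW.
split=> //; right; apply/in_DiscE => //.
by rewrite -enorm_sqr -/(edist z q) [2 * _]mulrC divfK ?pnatr_eq0// mulrC.
Qed.

Let stop_lb : lbound stop 0.
Proof. by move=> r []. Qed.

Lemma step_radius_ge0 : 0 <= step_radius S z q.
Proof. by apply: lb_le_inf => //; exists (edist z q / 2). Qed.

Lemma step_radius_le (r : R) : 0 <= r ->
  (exists s, [/\ S s, s <> z & Cone z q r s]) \/ Disc z q r q ->
  step_radius S z q <= r.
Proof. by move=> r0 h; apply: ge_inf; [exists 0 | split]. Qed.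

Lemma step_radius_half : step_radius S z q <= edist z q / 2.
Proof. by case: stop_half => r0; exact: step_radius_le. Qed.

(** The events that stop the growth are closed conditions on the radius, and
    there are finitely many of them, so the infimum is attained. *)
Lemma stopper_exists : ~ reaches S z q -> stoppers S z q !=set0.
Proof.
move=> nr; apply: contrapT => ns.
set r0 := step_radius S z q.
have r0_ge0 : 0 <= r0 := step_radius_ge0.
pose far p r := 2 * r * dot (vect z p) (vect z q) < edist z p ^+ 2 * edist z q.
have far_near p : far p r0 -> \forall r \near r0, far p r.
  rewrite /far -subr_gt0 => h.
  have c : (fun r => edist z p ^+ 2 * edist z q -
      2 * r * dot (vect z p) (vect z q)) @ r0 --> edist z p ^+ 2 * edist z q -
      2 * r0 * dot (vect z p) (vect z q).
    apply: cvgB; first exact: cvg_cst.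
    by do 2![apply: cvgM; last exact: cvg_cst || exact: cvg_id]; exact: cvg_cst.
  have hr : \forall r \near r0, 0 < edist z p ^+ 2 * edist z q - 2 * r * dot (vect z p) (vect z q).
    exact: cvgr_gt c _ h.
  by apply: filterS hr => r; rewrite subr_gt0.
have Disc_far p r : 0 <= r -> ~ Disc z q r p <-> far p r.
  move=> rge; rewrite in_DiscE // /far; split; first by move=> /negP; rewrite -ltNge.
  by rewrite ltNge => /negP.
have fq : far q r0 by apply/Disc_far.
pose cand i := x i <> z /\ cos (pi / 8) * (edist z (x i) * edist z q) <=
  dot (vect z (x i)) (vect z q).
have fx : \forall r \near r0, forall i, cand i -> far (x i) r.
  apply: (@filter_forall R _ (fun i r => cand i -> far (x i) r) (nbhs r0) _) => i.
  have [ci|ci] := pselect (cand i); last first.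
    by apply: nearW => r /ci.
  have : far (x i) r0.
    apply/Disc_far => // Di; apply: ns; exists (x i); split; first by exists i.
      by case: ci.
    by split=> //; case: ci.
  by move/far_near => hf; apply: filterS hf.
have : \forall r \near r0, ~ stop r.
  apply: filterS2 fx (far_near _ fq) => r fxr fqr [rge].
  case=> [[_ [[i _ <-] iz [Di ci]]]|]; last exact/Disc_far.
  by move: Di; apply/Disc_far => //; exact: fxr.
case/nbhs_ballP => e /= e0 he.
have [|r sr rlt] := @inf_adherent _ stop e e0.
  by split; [exists (edist z q / 2)|exists 0].
apply: (he r) (sr); rewrite /ball /= distrC ger0_norm; first by rewrite ltrBlDl.
by rewrite subr_ge0; apply: ge_inf sr; exists 0.
Qed.

End StepRadius.

(** * From one step to the walk *)

Section Walk.
Variables (R : realType) (n : nat) (x : 'I_n -> plane R).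
Let S : set (plane R) := range x.
Variable next : plane R -> plane R -> plane R.
Hypothesis nextP : forall z q, stoppers S z q !=set0 -> stoppers S z q (next z q).

Lemma cone_walk_sites z q i p : S z -> cone_walk S next z q i p -> S p.
Proof.
move=> Sz; elim=> // {}i {}p _ Sp pq nr.
by have [] := nextP (stopper_exists pq nr).
Qed.

Lemma max_neighbourhoods_le z q (m : nat) : S z ->
  (forall p, S p -> p <> q ->
     (sites_within x p (2 * step_radius S p q) <= m)%N) ->
  (max_neighbourhoods S next z q <= m%:R%:E)%E.
Proof.
move=> Sz h; apply: ge_ereal_sup => _ [->|[i [p [w pq ->]]]].
  by rewrite lee_fin.
have Sp := cone_walk_sites Sz w.
apply: le_trans (neighbourhoods_needed_le Sp pq (step_radius_ge0 x pq)) _.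
by rewrite lee_fin ler_nat h.
Qed.

Lemma max_neighbourhoods_le_sites z q : S z ->
  (max_neighbourhoods S next z q <= n%:R%:E)%E.
Proof.
move=> Sz; apply: max_neighbourhoods_le => // p _ _.
by rewrite -[X in (_ <= X)%N]card_ord max_card.
Qed.

End Walk.

(** * Room for a disc in a cone *)

Section ConeRoom.
Variable R : realType.

(** The exact value is [(2 + sqrt 2) / 4]. *)
Lemma cos_pi8_sqr : cos (pi / 8) ^+ 2 <= 9 / 10 :> R.
Proof.
have h2 := cos_mulr2n (pi / 4 : R); have h4 := cos_mulr2n (pi / 8 : R).
have e2 : (pi / 4) *+ 2 = pi / 2 :> R by rewrite mulr2n; lra.
have e4 : (pi / 8) *+ 2 = pi / 4 :> R by rewrite mulr2n; lra.
move: h2 h4; rewrite e2 e4 cos_pihalf.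
set a := cos (pi / 4); set b := cos (pi / 8) => h2 h4.
have : a <= 8 / 10 by rewrite leNgt; apply/negP => h; nra.
by rewrite mulr2n in h4; lra.
Qed.

Lemma sqr_le_bounds (a k : R) : 0 <= k -> a ^+ 2 <= k ^+ 2 -> - k <= a <= k.
Proof. by move=> k0 ak; apply/andP; split; rewrite leNgt; apply/negP => h; nra. Qed.

Definition segment_closed (E : set (plane R)) : Prop :=
  forall p q (t : R), 0 <= t <= 1 -> E p -> E q ->
    E ((1 - t) * p.1 + t * q.1, (1 - t) * p.2 + t * q.2).

Lemma segment_closed3 (E : set (plane R)) (a b c : R) p q w : segment_closed E ->
  0 <= a -> 0 <= b -> 0 <= c -> a + b + c = 1 -> E p -> E q -> E w ->
  E (a * p.1 + b * q.1 + c * w.1, a * p.2 + b * q.2 + c * w.2).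
Proof.
move=> cE a0 b0 c0 abc Ep Eq Ew.
have [c1|c1] := eqVneq c 1.
  have -> : a = 0 by lra.
  have -> : b = 0 by lra.
  by rewrite c1 !mul0r !mul1r !add0r; case: w Ew.
have c1' : 0 < 1 - c by rewrite subr_gt0 lt_neqAle c1; lra.
have c1'' : 1 - c != 0 by rewrite gt_eqF.
have t01 : 0 <= b / (1 - c) <= 1.
  by rewrite divr_ge0 ?(ltW c1')//= ler_pdivrMr // mul1r; lra.
have aE : 1 - b / (1 - c) = a / (1 - c).
  by apply: (mulIf c1''); rewrite mulrBl !divfK // mul1r; lra.
have := cE _ _ c _ (cE _ _ _ t01 Ep Eq) Ew.
rewrite /= aE; have -> : 0 <= c <= 1 by lra.
move=> /(_ isT); congr E; congr pair; field; exact: c1''.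
Qed.

(** In the frame at [z] with first axis along [zq] and second axis on the side
    of [o], the triangle spanned by [z], [q] and a highest point of the disc
    about [o] lies in [E]. Its angles at [z] and [q] are bounded below in terms
    of [rho / Delta] alone, hence so is the size, relative to [r], of a disc
    fitting in both the triangle and the cone. *)
Lemma cone_room (E : set (plane R)) (z q o : plane R) (rho Delta r : R) :
  segment_closed E -> E z -> E q ->
  (forall p, edist o p <= rho -> E p) ->
  (forall p p', E p -> E p' -> edist p p' <= Delta) ->
  0 < rho -> 0 < r -> 2 * r <= edist z q ->
  exists c, forall p, edist c p <= rho * r / (8 * Delta) ->
    [/\ E p, p <> z & Cone z q r p].
Proof.
move=> cE Ez Eq ball_o diam rho0 r0 rL.
have zq : z <> q by move=> e; move: rL; rewrite e edistxx; lra.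
have L0 := edist_gt0 zq.
have LD := diam _ _ Ez Eq.
have D0 : 0 < Delta by lra.
set L := edist z q in rL L0 LD *.
have [[u1 u2] [uu zqE]] : exists u : R * R, u.1 ^+ 2 + u.2 ^+ 2 = 1 /\
    vect z q = (L * u.1, L * u.2).
  exists ((vect z q).1 / L, (vect z q).2 / L); split => /=.
    by rewrite !expr_div_n -mulrDl /vect /= -edist_sqr mulfV // sqrf_eq0 gt_eqF.
  by rewrite ![L * _]mulrC !divfK ?gt_eqF//; case: (vect z q).
rewrite /= in uu zqE.
(* The sign [sg] turns the second axis of the frame towards [o]. *)
have [sg [sg2 ho]] : exists sg : R, sg ^+ 2 = 1 /\
    0 <= sg * (- u2 * (o.1 - z.1) + u1 * (o.2 - z.2)).
  have [h|h] := leP 0 (- u2 * (o.1 - z.1) + u1 * (o.2 - z.2)).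
    by exists 1; rewrite expr1n mul1r.
  by exists (-1); rewrite sqrrN expr1n mulN1r oppr_ge0 ltW.
pose X (p : plane R) := u1 * (p.1 - z.1) + u2 * (p.2 - z.2).
pose Y (p : plane R) := sg * (- u2 * (p.1 - z.1) + u1 * (p.2 - z.2)).
pose W (a b : R) : plane R := (z.1 + a * u1 - b * sg * u2, z.2 + a * u2 + b * sg * u1).
have WK p : p = W (X p) (Y p).
  rewrite /W /X /Y; case: p => p1 p2 /=.
  have e (A B : R) : sg * (A * sg) * B = A * B by rewrite mulrCA -expr2 sg2; ring.
  congr pair; apply/eqP; rewrite -subr_eq0; apply/eqP.
    transitivity ((p1 - z.1) * (1 - (u1 ^+ 2 + sg ^+ 2 * u2 ^+ 2))
      + (p2 - z.2) * u1 * u2 * (sg ^+ 2 - 1)); first by ring.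
    by rewrite sg2 mul1r uu; ring.
  transitivity ((p2 - z.2) * (1 - (u2 ^+ 2 + sg ^+ 2 * u1 ^+ 2))
      + (p1 - z.1) * u1 * u2 * (sg ^+ 2 - 1)); first by ring.
  by rewrite sg2 mul1r [u2 ^+ 2 + _]addrC uu; ring.
have dW a b a' b' : edist (W a b) (W a' b') ^+ 2 = (a' - a) ^+ 2 + (b' - b) ^+ 2.
  rewrite edist_sqr /W /=.
  transitivity ((a' - a) ^+ 2 * (u1 ^+ 2 + u2 ^+ 2) +
    (b' - b) ^+ 2 * sg ^+ 2 * (u1 ^+ 2 + u2 ^+ 2)); first by ring.
  by rewrite uu sg2 !mulr1.
have zW : z = W 0 0 by rewrite /W !mul0r !addr0 subr0; case: (z).
have qW : q = W L 0.
  move: zqE => []; rewrite /W !mul0r !addr0 subr0 => <- <-.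
  by case: (q) => a b /=; congr pair; ring.
have [h [a [Ew hrho aD hD]]] : exists h a, [/\ E (W a h), rho <= h, `|a| <= Delta & h <= Delta].
  exists (Y o + rho), (X o).
  have Ew : E (W (X o) (Y o + rho)).
    apply: ball_o; rewrite [Z in edist Z _](WK o) edist_ler ?(ltW rho0)// dW.
    by rewrite subrr expr0n add0r addrAC subrr add0r.
  have h0 : rho <= Y o + rho by rewrite lerDr.
  have := diam _ _ Ez Ew.
  rewrite zW edist_ler ?(ltW D0)// dW !subr0 => dd.
  have aD : X o ^+ 2 <= Delta ^+ 2 by apply: le_trans dd; rewrite lerDl sqr_ge0.
  have hD : (Y o + rho) ^+ 2 <= Delta ^+ 2 by apply: le_trans dd; rewrite lerDr sqr_ge0.
  split => //; first by rewrite ler_norml sqr_le_bounds // ltW.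
  by case/andP: (sqr_le_bounds (ltW D0) hD).
have Dh0 : 0 < h by lra.
exists (W r (rho * r / (8 * Delta))) => p.
set k := rho * r / (8 * Delta).
have rD : r <= Delta / 2 by lra.
have kE : k * (8 * Delta) = rho * r by rewrite /k divfK // gt_eqF //; lra.
have k0 : 0 < k by rewrite /k divr_gt0 ?mulr_gt0.
have kr : k <= r / 8.
  have hrD : rho <= Delta := le_trans hrho hD.
  have : rho * r <= Delta * r by rewrite ler_pM2r.
  by rewrite /k ler_pdivrMr ?mulr_gt0//; lra.
rewrite [in edist _ p](WK p) edist_ler ?(ltW k0)// dW.
set x := X p; set y := Y p => xy.
have xk : (x - r) ^+ 2 <= k ^+ 2 by apply: le_trans xy; rewrite lerDl sqr_ge0.
have yk : (y - k) ^+ 2 <= k ^+ 2 by apply: le_trans xy; rewrite lerDr sqr_ge0.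
(* With these bounds [y <= x / 3], and a slope of at most 1 / 3 keeps [p] in the
   cone since [cos (pi / 8) ^+ 2 * (1 + 1 / 9) <= 1]. *)
have [x1 x2] : 3 / 4 * r <= x /\ x <= 5 / 4 * r.
  by case/andP: (sqr_le_bounds (ltW k0) xk); split; lra.
have [y1 y2] : 0 <= y /\ y <= 2 * k.
  by case/andP: (sqr_le_bounds (ltW k0) yk); split; lra.
have pz : p <> z.
  by move=> e; move: x1; rewrite /x e /X !subrr !mulr0 addr0; lra.
have dzp : edist z p ^+ 2 = x ^+ 2 + y ^+ 2.
  by rewrite zW (WK p) dW !subr0.
have dotp : dot (vect z p) (vect z q) = L * x.
  by rewrite zqE /dot /vect /= /x /X; ring.
split=> //; last first.
  split.
    apply/in_DiscE => //; first exact: ltW.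
    rewrite dzp dotp -/L mulrCA -mulrA mulrC; apply: ler_wpM2l; first exact: ltW.
    by nra.
  rewrite /= dotp -/L mulrA mulrC ler_pM2l //.
  have x0 : 0 < x by lra.
  have [c0|c0] := leP (cos (pi / 8) : R) 0.
    by apply: le_trans (ltW x0); rewrite mulr_le0_ge0 // edist_ge0.
  rewrite -(ler_pXn2r (n := 2)) ?nnegrE ?mulr_ge0 ?edist_ge0 ?(ltW c0) ?(ltW x0)//.
  rewrite exprMn dzp.
  apply: le_trans (ler_wpM2r _ cos_pi8_sqr) _; first by rewrite addr_ge0 ?sqr_ge0.
  have y3 : y <= x / 3 by lra.
  have : y ^+ 2 <= (x / 3) ^+ 2 by rewrite ler_pXn2r ?nnegrE ?divr_ge0 ?(ltW x0).
  by lra.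
(* [b] and [g] are the barycentric coordinates of [p] at the vertices [q] and
   [W a h] of the triangle. *)
pose g := y / h; pose b := (x - g * a) / L.
have gh : g * h = y by rewrite /g divfK ?gt_eqF.
have bL : b * L = x - g * a by rewrite /b divfK ?gt_eqF.
have g0 : 0 <= g by rewrite /g divr_ge0 // ltW.
have gD : g * Delta <= r / 4.
  have h1 : g * rho <= y by rewrite -gh ler_wpM2l.
  have h2 : 2 * k * (4 * Delta) = rho * r by lra.
  rewrite -(ler_pM2r rho0).
  by have := ler_wpM2r (ltW D0) h1; have := ler_wpM2r (ltW D0) y2; lra.
have g8 : g <= 1 / 8 by rewrite -(ler_pM2r D0); lra.
have ga : `|g * a| <= r / 4.
  by rewrite normrM (ger0_norm g0); apply: le_trans gD; rewrite ler_wpM2l.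
move: ga; rewrite ler_norml => /andP[ga1 ga2].
have b0 : 0 <= b by rewrite /b divr_ge0 ?(ltW L0)//; lra.
have b1 : b <= 3 / 4 by rewrite /b ler_pdivrMr //; lra.
have := @segment_closed3 E (1 - b - g) b g _ _ _ cE _ b0 g0 _ Ez Eq Ew.
move=> H; have {H} : E ((1 - b - g) * z.1 + b * q.1 + g * (W a h).1,
    (1 - b - g) * z.2 + b * q.2 + g * (W a h).2) by apply: H; lra.
rewrite [X in E X -> _](_ : _ = p)//.
rewrite [RHS](WK p) -/x -/y; clearbody b g x y; rewrite qW /W /= !mul0r subr0 addr0.
have -> : x = b * L + g * a by rewrite bL subrK.
by rewrite -gh; congr pair; ring.
Qed.
End ConeRoom.

(** * Convex sets of unit area *)

Section Area.
Variable R : realType.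
Implicit Types (c p : R * R) (h : R) (A D : set (R * R)).

Definition square c h : set (R * R) :=
  `[c.1 - h, c.1 + h] `*` `[c.2 - h, c.2 + h].

Lemma squareP c h p : square c h p <-> `|p.1 - c.1| <= h /\ `|p.2 - c.2| <= h.
Proof. by rewrite /square /= !in_itv /= !ler_distl. Qed.

Lemma measurable_square c h : measurable (square c h).
Proof. by apply: measurableX; exact: measurable_itv. Qed.

Lemma area_square c h : 0 < h -> area (square c h) = (4 * h ^+ 2)%:E.
Proof.
move=> h0.
have itvE (a : R) : lebesgue_measure (`[a - h, a + h] : set R) = (2 * h)%:E.
  rewrite lebesgue_measure_itv /= lte_fin (_ : _ < _); last by lra.
  by rewrite -EFinB; congr EFin; ring.
rewrite /area /square product_measure1E //.
transitivity ((2 * h)%:E * (2 * h)%:E)%E.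
  by congr (_ * _)%E; exact: itvE.
by rewrite -EFinM; congr EFin; ring.
Qed.

Lemma le_area A B : measurable A -> measurable B -> A `<=` B ->
  (area A <= area B)%E.
Proof. by move=> mA mB AB; apply: le_measure; rewrite ?inE. Qed.

Lemma area_slab (a : R) D : measurable D ->
  (forall p, D p -> p.1 = a) -> area D = 0%E.
Proof.
move=> mD Da; apply/eqP; rewrite eq_le measure_ge0 andbT.
have -> : 0%E = area ([set a] `*` [set: R]).
  rewrite /area product_measure1E //; apply/esym/(etrans _ (mul0e _)).
  by congr (_ * _)%E; exact: lebesgue_measure_set1.
apply: le_area => //; first exact: measurableX.
by move=> p /Da.
Qed.

Lemma area_sections D : (forall a y y', D (a, y) -> D (a, y') -> y = y') ->
  area D = 0%E.
Proof.
move=> Dy; rewrite /area /product_measure1; apply: integral0_eq => a _ /=.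
have [[y Day]|nD] := pselect (exists y, D (a, y)).
  rewrite (_ : xsection D a = [set y]); first exact: lebesgue_measure_set1.
  by apply/seteqP; split => y' /=; rewrite /xsection /= inE; [move=> h; exact: Dy h Day | move=> ->].
rewrite (_ : xsection D a = set0) ?measure0//.
by apply/seteqP; split => y' //=; rewrite /xsection /= inE => h; apply: nD; exists y'.
Qed.

(** A convex set of positive area is contained neither in the graph of a
    function nor in a vertical line, so it contains a triangle with a vertical
    side. *)
Lemma square_inside D : measurable D -> segment_closed D -> area D <> 0%E ->
  exists o (rho : R), 0 < rho /\ square o rho `<=` D.
Proof.
move=> mD cD D0.
have [a [y1 [y2 [D1 D2 y12]]]] : exists a y1 y2, [/\ D (a, y1), D (a, y2) & y1 < y2].
  apply: contrapT => h; apply/D0/area_sections => a y y' Dy Dy'.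
  by have [yy|yy|//] := ltgtP y y'; exfalso; apply: h; exists a; [exists y, y'|exists y', y].
have [[b y3] D3 /= ba] : exists2 p, D p & p.1 <> a.
  apply: contrapT => h; apply/D0/(@area_slab a) => // p Dp.
  by apply: contrapT => pa; apply: h; exists p.
set dd := b - a; have d0 : dd != 0 by rewrite subr_eq0; apply/eqP.
set f := y2 - y1; have f0 : 0 < f by rewrite subr_gt0.
set e := y3 - y1.
(* A displacement of at most [1 / (6 M)] in each coordinate changes each of the
   barycentric coordinates [s] and [t] by at most 1 / 6. *)
pose M := `|dd^-1| + (1 + `|e / dd|) / f.
have M0 : 0 < M.
  by rewrite ltr_pwDl ?normr_gt0 ?invr_eq0// divr_ge0 ?(ltW f0)// addr_ge0.
exists ((a + a + b) / 3, (y1 + y2 + y3) / 3), (6 * M)^-1; split.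
  by rewrite invr_gt0 mulr_gt0.
set rho := (6 * M)^-1.
have rM : rho * M = 1 / 6 by rewrite /rho invfM -mulrA mulVf ?gt_eqF// mul1r mulr1.
have rho0 : 0 < rho by rewrite invr_gt0 mulr_gt0.
move=> [X Y] /squareP /=; set X' := X - _; set Y' := Y - _ => -[hX hY].
pose t := X' / dd; pose s := (Y' - e * t) / f.
have ht : `|t| <= 1 / 6.
  rewrite -rM /t normrM; apply: ler_pM => //.
  by rewrite /M lerDl divr_ge0 ?(ltW f0)// addr_ge0.
have hs : `|s| <= 1 / 6.
  rewrite /s normrM [X in _ * X]gtr0_norm ?invr_gt0// ler_pdivrMr//.
  have h1 : `|e * t| <= rho * `|e / dd|.
    by rewrite /t mulrCA normrM ler_wpM2r.
  have h2 : rho * (1 + `|e / dd|) <= 1 / 6 * f.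
    by rewrite -rM -mulrA ler_pM2l// -ler_pdivrMr// /M lerDr.
  by apply: le_trans (ler_normB _ _) _; lra.
move: ht hs; rewrite !ler_norml => /andP[t1 t2] /andP[s1 s2].
have := @segment_closed3 R D (1 / 3 - s - t) (1 / 3 + s) (1 / 3 + t) _ _ _ cD _ _ _ _
  D1 D2 D3.
move=> H; have {H} : D ((1 / 3 - s - t) * a + (1 / 3 + s) * a + (1 / 3 + t) * b,
  (1 / 3 - s - t) * y1 + (1 / 3 + s) * y2 + (1 / 3 + t) * y3) by apply: H; lra.
have tE : t * dd = X' by rewrite /t divfK.
have sE : s * f = Y' - e * t by rewrite /s divfK ?gt_eqF.
rewrite [Z in D Z -> _](_ : _ = (X, Y))//; clearbody t s; congr pair.
  have -> : X = X' + (a + a + b) / 3 by rewrite /X' subrK.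
  by rewrite -tE /dd; field.
have -> : Y = s * f + e * t + (y1 + y2 + y3) / 3 by rewrite sE /Y' subrK subrK.
by rewrite /f /e; field.
Qed.

(** Shrinking a square inside [D] towards a far away point of [D] gives
    arbitrarily many disjoint squares of a fixed size. *)
Lemma coord_bounded (j : R * R -> R) D o (rho : R) :
  (forall p q (t : R), j ((1 - t) * p.1 + t * q.1, (1 - t) * p.2 + t * q.2)
      = (1 - t) * j p + t * j q) ->
  (forall c h p, square c h p -> `|j p - j c| <= h) ->
  measurable D -> segment_closed D -> area D = 1%E ->
  0 < rho -> square o rho `<=` D ->
  exists K, forall p, D p -> `|j p - j o| <= K.
Proof.
move=> jlin jsq mD cD D1 rho0 oD.
pose N := (Num.truncn (rho ^- 2)).+1.
exists (2 * N%:R * rho) => p Dp; rewrite leNgt; apply/negP => far.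
have N0 : 0 < N%:R :> R by rewrite ltr0n.
have Nrho : 1 < N%:R * rho ^+ 2.
  by rewrite -ltr_pdivrMr ?exprn_gt0// mul1r truncnS_gt.
pose t (i : 'I_N) : R := i%:R / (2 * N%:R).
have t0 i : 0 <= t i by rewrite divr_ge0 ?mulr_ge0 ?ler0n.
have t1 i : t i <= 1 / 2.
  rewrite ler_pdivrMr ?mulr_gt0// (_ : 1 / 2 * _ = N%:R); last by field.
  by rewrite ler_nat ltnW.
pose c i : R * R := ((1 - t i) * o.1 + t i * p.1, (1 - t i) * o.2 + t i * p.2).
pose F i := square (c i) (rho / 2).
have FD i : F i `<=` D.
  move=> p' /squareP [/= h1 h2].
  have ti : 0 < 1 - t i by have := t1 i; lra.
  (* [b] is the point of the large square whose image is [p'] when the square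
     is shrunk towards [p]. *)
  pose b : R * R := (o.1 + (p'.1 - (c i).1) / (1 - t i),
                     o.2 + (p'.2 - (c i).2) / (1 - t i)).
  have Db : D b.
    apply: oD; apply/squareP => /=; rewrite ![_ + _ - _]addrAC !subrr !add0r.
    rewrite !normrM !(@gtr0_norm _ (_^-1)) ?invr_gt0// !ler_pdivrMr//.
    have : rho / 2 <= rho * (1 - t i).
      by have := ler_wpM2l (ltW rho0) (t1 i); lra.
    by move=> hr; split; [exact: le_trans h1 hr | exact: le_trans h2 hr].
  have : 0 <= t i <= 1 by rewrite t0 /=; have := t1 i; lra.
  move=> /(cD b p)/(_ Db Dp); congr D; rewrite /b /c; case: p' {h1 h2 b Db} => X Y /=.
  by congr pair; field; rewrite gt_eqF.
have mF i : measurable (F i) by exact: measurable_square.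
have Fdisj : trivIset [set: 'I_N] F.
  apply/trivIsetP => i k _ _ ik; apply/seteqP; split => // p' [/jsq hi /jsq hk].
  have jc m : j (c m) = j o + t m * (j p - j o) by rewrite jlin; ring.
  (* Centres of distinct squares differ by more than [rho] in the coordinate [j]. *)
  have ik1 : 1 / (2 * N%:R) <= `|t i - t k|.
    rewrite /t -mulrBl normrM (@gtr0_norm _ (_^-1)) ?invr_gt0 ?mulr_gt0//.
    rewrite ler_pM2r ?invr_gt0 ?mulr_gt0//.
    have [lt|lt|/val_inj e] := ltngtP i k; last by rewrite e eqxx in ik.
      have : i.+1%:R <= k%:R :> R by rewrite ler_nat.
      by rewrite -natr1 ler_normr => h; apply/orP; right; lra.
    have : k.+1%:R <= i%:R :> R by rewrite ler_nat.
    by rewrite -natr1 ler_normr => h; apply/orP; left; lra.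
  have : `|(t i - t k) * (j p - j o)| <= rho.
    rewrite (_ : _ * _ = (j p' - j (c k)) - (j p' - j (c i))); last by rewrite !jc; ring.
    by apply: le_trans (ler_normB _ _) _; lra.
  rewrite normrM leNgt => /negP; apply.
  have -> : rho = 1 / (2 * N%:R) * (2 * N%:R * rho) by field; rewrite gt_eqF.
  apply: le_lt_trans (ler_wpM2r _ ik1) _; first by rewrite !mulr_ge0// ltW.
  rewrite ltr_pM2l//; apply: lt_le_trans ik1; by rewrite divr_gt0 ?mulr_gt0.
have : ((N%:R * rho ^+ 2)%:E <= 1%:E :> \bar R)%E.
  rewrite -D1; apply: (@le_trans _ _ (area (\big[setU/set0]_(i < N) F i))).
    rewrite /area measure_bigsetU_ord//.
    rewrite (eq_bigr (fun=> (rho ^+ 2)%:E)).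
      by rewrite sumEFin sumr_const card_ord mulr_natl.
    by move=> i _; rewrite [LHS]area_square ?divr_gt0//; congr EFin; field.
  apply: le_area => //; first exact: bigsetU_measurable.
  by move=> p'; rewrite -bigcup_seq => -[i _]; exact: FD.
by rewrite lee_fin leNgt Nrho.
Qed.

End Area.

Section Domain.
Variable R : realType.
Implicit Types (c p : R * R) (D : set (R * R)).

Lemma convex_segment_closed D :
  @convex_set R (R^o * R^o)%type D -> segment_closed D.
Proof.
move=> cD p q t t01 Dp Dq.
pose l : {i01 R} := Itv01 (proj1 (andP t01)) (proj2 (andP t01)).
have := cD q p l; rewrite !inE => /(_ Dq Dp).
congr D; rewrite /conv /= /isConvexSpace.conv /=.
by rewrite addrC.
Qed.

Lemma domain_bounds D : measurable D -> segment_closed D -> area D = 1%E ->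
  exists o rho K, [/\ 0 < rho, 0 < K, square o rho `<=` D & D `<=` square (0, 0) K].
Proof.
move=> mD cD D1.
have [|o [rho [rho0 oD]]] := square_inside mD cD.
  by rewrite D1; apply/eqP; rewrite onee_neq0.
have [||K1 hK1] := @coord_bounded _ fst _ _ _ _ _ mD cD D1 rho0 oD => //.
  by move=> c h p /squareP[].
have [||K2 hK2] := @coord_bounded _ snd _ _ _ _ _ mD cD D1 rho0 oD => //.
  by move=> c h p /squareP[].
have Do : D o by apply: oD; apply/squareP; rewrite !subrr normr0 ltW.
have K10 := hK1 _ Do; have K20 := hK2 _ Do.
rewrite !subrr !normr0 in K10 K20.
exists o, rho, (K1 + K2 + `|o.1| + `|o.2| + 1); split => //.
  by have := normr_ge0 o.1; have := normr_ge0 o.2; lra.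
move=> p Dp; apply/squareP; rewrite !subr0.
have h1 := hK1 _ Dp; have h2 := hK2 _ Dp.
have e1 : `|p.1| <= `|p.1 - o.1| + `|o.1| by rewrite -[X in `|X| <= _](subrK o.1) ler_normD.
have e2 : `|p.2| <= `|p.2 - o.2| + `|o.2| by rewrite -[X in `|X| <= _](subrK o.2) ler_normD.
by have := normr_ge0 o.1; have := normr_ge0 o.2; split; lra.
Qed.

Lemma dilateE (a : R) D : a != 0 ->
  dilate a D = (fun p => (a^-1 * p.1, a^-1 * p.2)) @^-1` D.
Proof.
move=> a0; apply/seteqP; split => [_ [p Dp <-]|p Dp] /=.
  by rewrite !mulKf//; case: p Dp.
by exists (a^-1 * p.1, a^-1 * p.2) => //=; rewrite !mulVKf//; case: p Dp.
Qed.

Lemma measurable_dilate (a : R) D : a != 0 -> measurable D -> measurable (dilate a D).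
Proof.
move=> a0 mD; rewrite dilateE//.
have mf : measurable_fun setT (fun p : R * R => (a^-1 * p.1, a^-1 * p.2)).
  by apply: measurable_fun_pair => /=; apply: measurable_funM => //.
by rewrite -[X in measurable X]setTI; exact: mf.
Qed.

Lemma segment_closed_dilate (a : R) D : segment_closed D -> segment_closed (dilate a D).
Proof.
move=> cD _ _ t t01 [p Dp <-] [q Dq <-] /=; have := cD _ _ _ t01 Dp Dq.
by move=> h; exists ((1 - t) * p.1 + t * q.1, (1 - t) * p.2 + t * q.2) => //=; congr pair; ring.
Qed.

Lemma square_sub_dilate (a : R) D o (rho : R) : 0 < a -> square o rho `<=` D ->
  square (a * o.1, a * o.2) (a * rho) `<=` dilate a D.
Proof.
move=> a0 oD p /squareP /= [h1 h2]; rewrite dilateE ?gt_eqF//; apply: oD.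
apply/squareP => /=.
by split; rewrite -(ler_pM2l a0) -[X in X * `|_|](gtr0_norm a0) -normrM mulrBr mulVKf ?gt_eqF.
Qed.

Lemma dilate_sub_square (a : R) D (K : R) : 0 < a -> D `<=` square (0, 0) K ->
  dilate a D `<=` square (0, 0) (a * K).
Proof.
move=> a0 DK _ [p /DK /squareP[/= h1 h2] <-]; apply/squareP => /=.
by move: h1 h2; rewrite !subr0 !normrM gtr0_norm// !ler_pM2l.
Qed.

End Domain.

(** * Uniform points and squares *)

Section Uniform.
Context (d : measure_display) (T : measurableType d) (R : realType).
Variable P : probability T R.
Implicit Types (E A B : set (R * R)) (h K rho : R).

(** The sizes of an inner and of an outer square are all that is used about
    the area of the domain. *)
Lemma area_between E o rho K : measurable E -> 0 < rho -> 0 < K ->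
  square o rho `<=` E -> E `<=` square (0, 0) K ->
  exists v, [/\ area E = v%:E, 4 * rho ^+ 2 <= v & v <= 4 * K ^+ 2].
Proof.
move=> mE rho0 K0 oE EK.
have h1 := le_area (measurable_square o rho) mE oE.
have h2 := le_area mE (measurable_square (0, 0) K) EK.
rewrite !area_square// in h1 h2.
have fE : area E \is a fin_num.
  by rewrite ge0_fin_numE ?(le_lt_trans h2) ?ltry// measure_ge0.
move: h1 h2; rewrite -(fineK fE) !lee_fin => h1 h2.
by exists (fine (area E)).
Qed.

Variables (E : set (R * R)) (o : R * R) (rho K : R).
Hypotheses (mE : measurable E) (rho0 : 0 < rho) (K0 : 0 < K).
Hypotheses (oE : square o rho `<=` E) (EK : E `<=` square (0, 0) K).
Variable X : {RV P >-> (R * R)%type}.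
Hypothesis unifX : uniform_on E X.

Lemma uniform_in_square g h : 0 < h -> square g h `<=` E ->
  ((h ^+ 2 / K ^+ 2)%:E <= P (X @^-1` square g h))%E.
Proof.
move=> h0 gE; have [v [vE v1 v2]] := area_between mE rho0 K0 oE EK.
have v0 : 0 < v by apply: lt_le_trans v1; rewrite mulr_gt0// exprn_gt0.
have := unifX (measurable_square g h).
rewrite /distribution /pushforward => ->.
rewrite setIidl// vE area_square// inver gt_eqF// -EFinM lee_fin.
rewrite ler_pdivlMr// mulrAC ler_pdivrMr ?exprn_gt0//.
have := ler_wpM2l (sqr_ge0 h) v2; lra.
Qed.

Lemma uniform_square_le g h : 0 < h ->
  (P (X @^-1` square g h) <= (h ^+ 2 / rho ^+ 2)%:E)%E.
Proof.
move=> h0; have [v [vE v1 v2]] := area_between mE rho0 K0 oE EK.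
have v0 : 0 < v by apply: lt_le_trans v1; rewrite mulr_gt0// exprn_gt0.
have := unifX (measurable_square g h).
rewrite /distribution /pushforward => ->.
rewrite vE inver gt_eqF// lee_pdivrMr// -EFinM.
apply: le_trans (_ : (4 * h ^+ 2)%:E <= _)%E.
  rewrite -(area_square g h0); apply: le_area; last 1 first.
  - exact: subIsetl.
  - by apply: measurableI => //; exact: measurable_square.
  - exact: measurable_square.
rewrite lee_fin mulrAC ler_pdivlMr ?exprn_gt0//.
have := ler_wpM2l (sqr_ge0 h) v1; lra.
Qed.

Lemma uniform_outside : P (X @^-1` (~` E)) = 0%E.
Proof.
have := unifX (measurableC mE).
rewrite /distribution /pushforward => ->.
by rewrite setICl /area measure0 mul0e.
Qed.

End Uniform.

(** * Configurations with occupied and uncrowded squares *)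

Section GoodConfiguration.
Variables (R : realType) (n : nat) (x : 'I_n -> plane R).
Let S : set (plane R) := range x.
Variables (E : set (R * R)) (o : R * R) (rho K s : R) (k : nat).

(** As soon as [2 * K < s * n], these [n ^ 2] points come within [s], in each
    coordinate, of every point of the square of half-side [K] about the
    origin. *)
Definition lattice (g : 'I_n * 'I_n) : R * R := (s * g.1%:R - K, s * g.2%:R - K).

(** The radius for which [cone_room], in a domain of diameter at most [3 K],
    provides a disc of radius [3 s]: by [square_edist] such a disc contains the
    square of half-side [s] about a lattice point near its centre. *)
Definition cone_size : R := 72 * K * s / rho.

Lemma lattice_dense p : 0 < s -> 2 * K < s * n%:R -> square (0, 0) K p ->
  exists g, square (lattice g) s p.
Proof.
move=> s0 Kn /squareP[/=]; rewrite !subr0 => h1 h2.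
have cover (a : R) : `|a| <= K -> exists i : 'I_n, `|a - (s * i%:R - K)| <= s.
  rewrite ler_norml => /andP[a1 a2].
  have a0 : 0 <= (a + K) / s by rewrite divr_ge0 ?(ltW s0)//; lra.
  have lt : (Num.truncn ((a + K) / s) < n)%N.
    by rewrite truncn_lt_nat// ltr_pdivrMr// mulrC; lra.
  exists (Ordinal lt) => /=; set m := Num.truncn _.
  have /andP[m1 m2] : m%:R <= (a + K) / s < m.+1%:R by exact: truncn_itv.
  move: m1 m2; rewrite ler_pdivlMr// ltr_pdivrMr// -natr1 => m1 m2.
  by rewrite ler_norml; apply/andP; split; lra.
have [i hi] := cover _ h1; have [j hj] := cover _ h2.
by exists (i, j); apply/squareP.
Qed.

Lemma edist_square p p' (r : R) : edist p p' <= r -> square p r p'.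
Proof.
move=> h; have r0 : 0 <= r := le_trans (edist_ge0 _ _) h.
move: h; rewrite edist_ler// edist_sqr => h; apply/squareP.
by split; rewrite ler_norml sqr_le_bounds//; apply: le_trans h; rewrite ?lerDl ?lerDr sqr_ge0.
Qed.

Lemma square_edist p p' (r : R) : square p (2 * r) p' -> edist p p' <= 3 * r.
Proof.
move=> /squareP[]; rewrite !ler_norml => /andP[a1 a2] /andP[b1 b2].
rewrite edist_ler; last by lra.
by rewrite edist_sqr; nra.
Qed.

Hypotheses (cE : segment_closed E) (rho0 : 0 < rho) (K0 : 0 < K) (s0 : 0 < s).
Hypotheses (oE : square o rho `<=` E) (EK : E `<=` square (0, 0) K).
Hypothesis Kn : 2 * K < s * n%:R.
Hypothesis sites_in : forall i, E (x i).
Hypothesis occupied : forall g, square (lattice g) s `<=` E ->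
  exists i, square (lattice g) s (x i).
Hypothesis uncrowded : forall g,
  (#|[pred i | `[< square (lattice g) (2 * cone_size + s) (x i) >]]| < k)%N.

Lemma cone_size_gt0 : 0 < cone_size.
Proof. by rewrite divr_gt0// !mulr_gt0. Qed.

Lemma square_shift a b c (r t : R) : square a r b -> square b t c -> square a (r + t) c.
Proof.
move=> /squareP[a1 a2] /squareP[b1 b2]; apply/squareP; split.
  by rewrite -(subrKA b.1) addrC; apply: le_trans (ler_normD _ _) _; rewrite lerD.
by rewrite -(subrKA b.2) addrC; apply: le_trans (ler_normD _ _) _; rewrite lerD.
Qed.

Lemma square_sym a b (r : R) : square a r b -> square b r a.
Proof. by move=> /squareP[a1 a2]; apply/squareP; rewrite distrC [`|a.2 - _|]distrC. Qed.

(** If [q] is not already within reach, a lattice square fits in the part of the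
    cone lying in [E]; the site in that square stops the growth. *)
Lemma step_radius_le_cone_size p q : S p -> E q -> p <> q ->
  step_radius S p q <= cone_size.
Proof.
move=> [ip _ xp] Eq pq; have Ep : E p by rewrite -xp.
have [le|lt] := leP (edist p q) (2 * cone_size).
  by apply: le_trans (step_radius_half x pq) _; lra.
have ball_o p' : edist o p' <= rho -> E p' by move/edist_square/oE.
have diam p' p'' : E p' -> E p'' -> edist p' p'' <= 3 * K.
  move=> /EK/squareP[/=]; rewrite !subr0 !ler_norml => /andP[a1 a2] /andP[b1 b2].
  move=> /EK/squareP[/=]; rewrite !subr0 !ler_norml => /andP[c1 c2] /andP[d1 d2].
  by apply: square_edist; apply/squareP; rewrite !ler_norml; split; lra.
have [c hc] := cone_room cE Ep Eq ball_o diam rho0 cone_size_gt0 (ltW lt).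
have radiusE : rho * cone_size / (8 * (3 * K)) = 3 * s.
  by rewrite /cone_size; field; rewrite !gt_eqF.
rewrite radiusE in hc.
have [Ec _ _] : [/\ E c, c <> p & Cone p q cone_size c].
  by apply: hc; rewrite edistxx mulr_ge0 ?ler0n ?(ltW s0).
have [g gc] := lattice_dense s0 Kn (EK Ec).
have gsub p' : square (lattice g) s p' -> edist c p' <= 3 * s.
  move=> gp'; apply: square_edist.
  by rewrite (_ : 2 * s = s + s) ?mulr2n; [exact: square_shift (square_sym gc) gp'|lra].
have [i /gsub/hc[_ ne ci]] : exists i, square (lattice g) s (x i).
  by apply: occupied => p' /gsub/hc[].
apply: step_radius_le => //; first exact/ltW/cone_size_gt0.
by left; exists (x i); split => //; exists i.
Qed.

Lemma sites_within_step p q : S p -> E q -> p <> q ->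
  (sites_within x p (2 * step_radius S p q) < k)%N.
Proof.
move=> Sp Eq pq; have Ep : E p by case: Sp => i _ <-.
have [g gp] := lattice_dense s0 Kn (EK Ep).
apply: leq_ltn_trans (uncrowded g); apply: subset_leq_card.
apply/fintype.subsetP => i; rewrite !inE => h.
rewrite [_ + s]addrC.
apply: square_shift gp _; apply: edist_square; apply: le_trans h _.
by rewrite ler_pM2l//; exact: step_radius_le_cone_size.
Qed.

End GoodConfiguration.

(** * Occupation of a set by independent points *)

Section UnionBound.
Context (d : measure_display) (T : measurableType d) (R : realType).
Variable P : probability T R.

Lemma bigsetUP (I : finType) (A : pred I) (F : I -> set T) w :
  (\big[setU/set0]_(i | A i) F i) w <-> exists2 i, A i & F i w.
Proof.
rewrite -bigcup_seq_cond; split.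
  by case=> i /= /andP[_ Ai] Fi; exists i.
by case=> i Ai Fi; exists i => //=; rewrite mem_index_enum.
Qed.

Lemma union_bound (I : finType) (A : pred I) (F : I -> set T) (b : R) :
  (forall i, A i -> measurable (F i)) -> (forall i, A i -> (P (F i) <= b%:E)%E) ->
  0 <= b -> (P (\big[setU/set0]_(i | A i) F i) <= (#|A|%:R * b)%:E)%E.
Proof.
move=> mF Fb b0.
have : measurable (\big[setU/set0]_(i | A i) F i) /\
    (P (\big[setU/set0]_(i | A i) F i) <= (\sum_(i | A i) b)%:E)%E.
  elim/big_rec2: _ => [|i x B Ai [mB hB]]; first by rewrite measure0.
  split; first by apply: measurableU => //; exact: mF.
  apply: le_trans (measureU2 _ _ _) _ => //; first exact: mF.
  by rewrite EFinD; apply: leeD => //; exact: Fb.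
by case=> _; rewrite sumr_const mulr_natl.
Qed.

End UnionBound.

Section Independence.
Context (d : measure_display) (T : measurableType d) (R : realType).
Variables (P : probability T R) (n : nat) (X : 'I_n -> {RV P >-> (R * R)%type}).
Hypothesis indepX : mutually_independent X.

Lemma probability_fine (A : set T) : measurable A -> ((fine (P A))%:E = P A)%E.
Proof. by move=> mA; rewrite fineK// fin_num_measure. Qed.

Lemma measurable_RV_preimage i (B : set (R * R)) : measurable B ->
  measurable (X i @^-1` B).
Proof. by move=> mB; rewrite -[X in measurable X]setTI; exact: measurable_funPT. Qed.

Lemma measurable_all_in (A : 'I_n -> set (R * R)) : (forall i, measurable (A i)) ->
  measurable (\bigcap_i (X i @^-1` A i)).
Proof.
move=> mA; rewrite -[X in measurable X]setCK setC_bigcap; apply: measurableC.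
apply: fin_bigcup_measurable => // i _; apply: measurableC.
exact: measurable_RV_preimage.
Qed.

Lemma probability_all_in (A : 'I_n -> set (R * R)) (b : 'I_n -> R) :
  (forall i, measurable (A i)) -> (forall i, (P (X i @^-1` A i) <= (b i)%:E)%E) ->
  (P (\bigcap_i (X i @^-1` A i)) <= (\prod_(i < n) b i)%:E)%E.
Proof.
move=> mA Ab; rewrite indepX//.
rewrite (eq_bigr (fun i => (fine (P (X i @^-1` A i)))%:E)); last first.
  by move=> i _; rewrite probability_fine//; exact: measurable_RV_preimage.
rewrite prodEFin lee_fin; apply: ler_prod => i _.
rewrite fine_ge0//= -lee_fin probability_fine//; exact: measurable_RV_preimage.
Qed.

Definition unoccupied (B : set (R * R)) : set T := \bigcap_i (X i @^-1` (~` B)).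

Lemma measurable_unoccupied B : measurable B -> measurable (unoccupied B).
Proof. by move=> mB; apply: measurable_all_in => i; exact: measurableC. Qed.

Lemma probability_unoccupied B (a : R) : measurable B ->
  (forall i, (a%:E <= P (X i @^-1` B))%E) ->
  (P (unoccupied B) <= (expR (- (n%:R * a)))%:E)%E.
Proof.
move=> mB aB.
have -> : expR (- (n%:R * a)) = \prod_(i < n) expR (- a).
  by rewrite prodr_const card_ord -expRM_natl mulrN.
apply: probability_all_in => i; first exact: measurableC.
rewrite preimage_setC probability_setC; last exact: measurable_RV_preimage.
apply: (@le_trans _ _ (1 - a%:E)%E); first by apply: leeB => //; exact: aB.
by rewrite -EFinB lee_fin expR_ge1Dx.
Qed.

(** At least [k] sites in [B], as a union over the possible sets of [k] labels. *)
Definition crowded (B : set (R * R)) (k : nat) : set T :=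
  \big[setU/set0]_(J : {set 'I_n} | #|J| == k)
    \bigcap_i (X i @^-1` (if i \in J then B else setT)).

Lemma crowdedP B k w : (k <= #|[pred i | `[< B (X i w) >]]|)%N -> crowded B k w.
Proof.
move=> /card_geqP[s [us sk sB]]; apply/bigsetUP; exists [set i in s]%SET.
  by rewrite cardsE (card_uniqP us) sk.
move=> i _ /=; rewrite inE; case: ifPn => // /sB; by rewrite !inE.
Qed.

Lemma measurable_crowded B k : measurable B -> measurable (crowded B k).
Proof.
move=> mB; apply: bigsetU_measurable => J _; apply: measurable_all_in => i.
by case: ifP.
Qed.

Lemma probability_crowded B k (a : R) : measurable B -> 0 <= a ->
  (forall i, (P (X i @^-1` B) <= a%:E)%E) ->
  (P (crowded B k) <= ((n%:R * a) ^+ k / k`!%:R)%:E)%E.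
Proof.
move=> mB a0 aB.
have mI (J : {set 'I_n}) i : measurable (if i \in J then B else setT) by case: ifP.
apply: (@le_trans _ _ (#|[pred J : {set 'I_n} | #|J| == k]|%:R * a ^+ k)%:E).
  apply: union_bound; last exact: exprn_ge0.
  - by move=> J _; exact: measurable_all_in.
  - move=> J /= /eqP Jk.
    have -> : a ^+ k = \prod_(i < n) (if i \in J then a else 1).
      by rewrite -big_mkcond prodr_const Jk.
    apply: probability_all_in => // i; case: ifP => // _.
    by rewrite preimage_setT probability_setT.
rewrite lee_fin ler_pdivlMr ?ltr0n ?fact_gt0// exprMn mulrAC.
apply: ler_wpM2r; first exact: exprn_ge0.
rewrite -natrX -natrM ler_nat.
have -> : #|[pred J : {set 'I_n} | #|J| == k]| = 'C(n, k).
  by rewrite -[in RHS](card_ord n) -card_draws cardsE; apply: eq_card.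
rewrite bin_ffact ffact_prod.
rewrite -[X in (_ <= _ ^ X)%N](card_ord k) -prod_nat_const.
by apply: leq_prod => i _; exact: leq_subr.
Qed.

End Independence.

(** * Asymptotic estimates *)

Section Numerics.
Variable R : realType.

(** A Poisson tail: [(2 b) ^ k / k!] is a term of the series of [expR (2 b)], and
    [2 ^ - k <= expR (- k / 2)]. *)
Lemma pow_div_fact (b : R) k : 0 <= b -> (0 < k)%N ->
  b ^+ k / k`!%:R <= expR (2 * b - k%:R / 2).
Proof.
move=> b0; case: k => // k _.
have h1 : (2 * b) ^+ k.+1 / (k.+1)`!%:R <= expR (2 * b).
  by have := @expR_ge1Dxn R (2 * b) k; rewrite mulr_ge0// => /(_ isT); lra.
have h2 : (1 / 2) ^+ k.+1 <= expR (- (k.+1%:R / 2)) :> R.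
  rewrite (_ : - _ = k.+1%:R * (- (1 / 2))); last by field.
  rewrite expRM_natl ler_pXn2r ?nnegrE ?expR_ge0 ?divr_ge0//.
  by have := @expR_ge1Dx R (- (1 / 2)); lra.
rewrite expRD; apply: le_trans (ler_pM _ _ h1 h2).
- by rewrite le_eqVlt; apply/orP; left; apply/eqP; rewrite mulrAC -exprMn; congr (_ ^+ _ / _); field.
- by rewrite divr_ge0 ?exprn_ge0 ?mulr_ge0.
- by rewrite exprn_ge0// divr_ge0.
Qed.

Lemma near_ln_ge (c : R) : \forall n \near \oo, c <= ln (n%:R : R).
Proof.
exists (Num.truncn (expR c)).+1 => // n /= hn.
rewrite -[c]expRK ler_ln ?posrE ?expR_gt0//; last first.
  by rewrite ltr0n; apply: leq_trans hn.
apply/ltW/(lt_le_trans (truncnS_gt _)); by rewrite ler_nat.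
Qed.

End Numerics.

(** * The exceptional event *)

Section TypicalConfiguration.
Context (d : measure_display) (T : measurableType d) (R : realType).
Variables (P : probability T R) (n : nat) (X : 'I_n -> {RV P >-> (R * R)%type}).
Hypothesis indepX : mutually_independent X.
Variables (D : set (R * R)) (o : R * R) (rho K : R).
Hypotheses (mD : measurable D) (cD : segment_closed D).
Hypotheses (rho0 : 0 < rho) (K0 : 0 < K).
Hypotheses (oD : square o rho `<=` D) (DK : D `<=` square (0, 0) K).
Hypothesis unifX : forall i, uniform_on (dilate (Num.sqrt n%:R) D) (X i).

(** [crowd_rate * ln n] bounds the mean number of sites in a square of half-side
    [2 * cone_size + s]. *)
Definition crowd_rate : R := 4 * K ^+ 2 * (144 * K / rho + 1) ^+ 2 / rho ^+ 2.

(* This makes [ln n ^ 3 / 2] exceed [(2 * crowd_rate + 4) * ln n], as the Poisson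
   tail requires. *)
Hypothesis large : 4 * crowd_rate + 9 <= ln (n%:R : R).

Let a : R := Num.sqrt n%:R.
Let l : R := ln n%:R.
(* The mean number of sites in a square of half-side [s] is then at least
   [n * s ^ 2 / (a * K) ^ 2 = 4 * ln n]. *)
Let s : R := 2 * K * Num.sqrt l.
Let k : nat := (Num.truncn (l ^+ 3)).+1.
Let E : set (R * R) := dilate a D.
Let wide : R := 2 * cone_size (a * rho) (a * K) s + s.
Let cell (g : 'I_n * 'I_n) : R * R := lattice (a * K) s g.

Let rate_ge0 : 0 <= crowd_rate.
Proof. by rewrite divr_ge0 ?sqr_ge0// mulr_ge0 ?sqr_ge0// mulr_ge0 ?sqr_ge0. Qed.

Let l9 : 9 <= l. Proof. by apply: le_trans large; rewrite lerDr mulr_ge0. Qed.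

Let n0 : 0 < n%:R :> R.
Proof.
rewrite lt_neqAle ler0n andbT; apply/eqP => e; move: l9; rewrite /l -e ln0//; lra.
Qed.

Let ln_lt_n : l < n%:R. Proof. exact: ln_sublinear. Qed.

Let a0 : 0 < a. Proof. by rewrite sqrtr_gt0. Qed.
Let a2 : a ^+ 2 = n%:R. Proof. by rewrite sqr_sqrtr// ltW. Qed.
Let l2 : Num.sqrt l ^+ 2 = l. Proof. by rewrite sqr_sqrtr//; have := l9; lra. Qed.
Let s0 : 0 < s.
Proof. by rewrite !mulr_gt0// sqrtr_gt0; have := l9; lra. Qed.

Let wideE : wide = (144 * K / rho + 1) * s.
Proof. by rewrite /wide /cone_size; field; rewrite !gt_eqF. Qed.

Let wide0 : 0 < wide.
Proof. by rewrite wideE mulr_gt0// addr_gt0// divr_gt0// mulr_gt0. Qed.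

Let mE : measurable E. Proof. by apply: measurable_dilate => //; rewrite gt_eqF. Qed.
Let oE : square (a * o.1, a * o.2) (a * rho) `<=` E.
Proof. exact: square_sub_dilate. Qed.
Let EK : E `<=` square (0, 0) (a * K). Proof. exact: dilate_sub_square. Qed.

Let expR_l4 : expR (- (4 * l)) = (n%:R ^+ 4)^-1.
Proof. by rewrite expRN expRM_natl /l lnK// posrE. Qed.

Definition atypical : set T :=
  \big[setU/set0]_(i < n) (X i @^-1` (~` E)) `|`
  \big[setU/set0]_(g | `[< square (cell g) s `<=` E >]) unoccupied X (square (cell g) s) `|`
  \big[setU/set0]_g crowded X (square (cell g) wide) k.

Lemma measurable_atypical : measurable atypical.
Proof.
apply: measurableU; first apply: measurableU.
- by apply: bigsetU_measurable => i _; exact/measurable_RV_preimage/measurableC.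
- by apply: bigsetU_measurable => g _; apply: measurable_unoccupied; exact: measurable_square.
- by apply: bigsetU_measurable => g _; apply: measurable_crowded; exact: measurable_square.
Qed.

Let cells_le (A : pred ('I_n * 'I_n)) : #|A|%:R <= n%:R ^+ 2 :> R.
Proof.
rewrite -natrX ler_nat; apply: leq_trans (max_card _) _.
by rewrite card_prod card_ord mulnn.
Qed.

Let cells_bound (A : pred ('I_n * 'I_n)) (F : 'I_n * 'I_n -> set T) :
  (forall g, A g -> measurable (F g)) ->
  (forall g, A g -> (P (F g) <= (expR (- (4 * l)))%:E)%E) ->
  (P (\big[setU/set0]_(g | A g) F g) <= (n%:R ^- 2)%:E)%E.
Proof.
move=> mF Fb; apply: le_trans (union_bound mF Fb (expR_ge0 _)) _.
rewrite lee_fin expR_l4 ler_pdivrMr ?exprn_gt0//.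
by rewrite (_ : _ * _ = n%:R ^+ 2)//; field; rewrite gt_eqF.
Qed.

(** Each of the two families of [n ^ 2] events of probability at most [n ^ -4]
    contributes [n ^ -2], and [2 * n ^ -2 <= 1 / n]. *)
Lemma probability_atypical : (P atypical <= (n%:R^-1)%:E)%E.
Proof.
have mout i : measurable (X i @^-1` (~` E)).
  exact/measurable_RV_preimage/measurableC.
have h1 : (P (\big[setU/set0]_(i < n) (X i @^-1` (~` E))) <= 0%:E)%E.
  rewrite -(mulr0 (#|predT : pred 'I_n|%:R)); apply: union_bound => // i _.
  by rewrite (uniform_outside mE (unifX i)).
have h2 : (P (\big[setU/set0]_(g | `[< square (cell g) s `<=` E >])
    unoccupied X (square (cell g) s)) <= (n%:R ^- 2)%:E)%E.
  apply: cells_bound => g /asboolP gE.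
    by apply: measurable_unoccupied; exact: measurable_square.
  rewrite (_ : 4 * l = n%:R * (s ^+ 2 / (a * K) ^+ 2)).
    apply: probability_unoccupied => // [|i]; first exact: measurable_square.
    by apply: (uniform_in_square mE _ _ oE EK (unifX i)) => //; exact: mulr_gt0.
  rewrite /s !exprMn l2 a2; field; by rewrite !gt_eqF.
have h3 : (P (\big[setU/set0]_g crowded X (square (cell g) wide) k) <= (n%:R ^- 2)%:E)%E.
  apply: cells_bound => g _; first by apply: measurable_crowded; exact: measurable_square.
  pose p := wide ^+ 2 / (a * rho) ^+ 2.
  have np : n%:R * p = crowd_rate * l.
    rewrite /p wideE /s /crowd_rate !exprMn l2 a2; field; by rewrite !gt_eqF.
  have hp i : (P (X i @^-1` square (cell g) wide) <= p%:E)%E.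
    by apply: (uniform_square_le mE _ _ oE EK (unifX i)) => //; exact: mulr_gt0.
  have p0 : 0 <= p by rewrite divr_ge0 ?sqr_ge0.
  apply: le_trans (probability_crowded indepX k (measurable_square _ _) p0 hp) _.
  rewrite lee_fin np; apply: le_trans (pow_div_fact _ _) _ => //.
    by rewrite mulr_ge0//; have := l9; lra.
  rewrite ler_expR.
  have kl : l ^+ 3 <= k%:R by apply: ltW; exact: truncnS_gt.
  have L := large; rewrite -/l in L.
  have h : (4 * crowd_rate + 8) * l <= l ^+ 3.
    rewrite exprSr ler_pM2r; last by have := l9; lra.
    rewrite expr2; apply: (@le_trans _ _ (1 * l)); first by lra.
    by rewrite ler_pM2r; have := l9; lra.
  lra.
rewrite /atypical.
have m12 := measurableU _ _ (bigsetU_measurable _ (fun i _ => mout i))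
  (bigsetU_measurable _ (fun g _ => measurable_unoccupied X (measurable_square (cell g) s))).
have m3 := bigsetU_measurable _ (fun g _ => measurable_crowded X k (measurable_square (cell g) wide)).
apply: le_trans (measureU2 _ _ _) _; [exact: m12|exact: m3|].
apply: le_trans (leeD (measureU2 _ _ _) (le_refl _)) _.
- by apply: bigsetU_measurable => i _; exact: mout.
- by apply: bigsetU_measurable => g _; apply: measurable_unoccupied; exact: measurable_square.
apply: le_trans (leeD (leeD h1 h2) h3) _.
rewrite -!EFinD lee_fin add0r.
have v0 : 0 < n%:R^-1 :> R by rewrite invr_gt0.
have v1 : n%:R^-1 <= 1 / 2 :> R.
  by rewrite div1r lef_pV2 ?posrE//; have := ln_lt_n; have := l9; lra.
rewrite -exprVn expr2; have := ler_wpM2l (ltW v0) v1; lra.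
Qed.

Lemma typical_sites_within w : ~ atypical w ->
  let x := fun i => X i w in
  forall p q, range x p -> E q -> p <> q ->
  (sites_within x p (2 * step_radius (range x) p q) <= Num.truncn (l ^+ 3))%N.
Proof.
move=> typ x p q Sp Eq pq; rewrite -ltnS -/k.
apply: (@sites_within_step R n x E (a * o.1, a * o.2) (a * rho) (a * K) s k) => //.
- exact: segment_closed_dilate.
- exact: mulr_gt0.
- exact: mulr_gt0.
- have n9 : 9 < n%:R :> R by have := l9; have := ln_lt_n; lra.
  have l1 : 1 <= Num.sqrt l.
    by rewrite -[X in X <= _]sqrtr1 ler_sqrt; have := l9; lra.
  have an : a < n%:R.
    rewrite -(ltr_pM2l a0) -expr2 a2 -[X in X < _]mul1r ltr_pM2r//.
    rewrite -[X in X < _]sqrtr1 ltr_sqrt; lra.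
  have le : 2 * K * 1 <= s by rewrite /s ler_pM2l// mulr_gt0.
  apply: (@lt_le_trans _ _ (2 * K * n%:R)).
    by rewrite [a * K]mulrC mulrA ltr_pM2l// mulr_gt0.
  by rewrite -[X in X * n%:R]mulr1 ler_pM2r.
- move=> i; apply: contrapT => out; apply: typ; left; left.
  by apply/bigsetUP; exists i.
- move=> g gE; apply: contrapT => empty; apply: typ; left; right.
  apply/bigsetUP; exists g; first exact/asboolP.
  by move=> i _ xi; apply: empty; exists i.
- move=> g; rewrite ltnNge; apply/negP => many; apply: typ; right.
  by apply/bigsetUP; exists g => //; exact: crowdedP.
Qed.

End TypicalConfiguration.

(** * Assembling the bounds *)

(** The right-hand side is the integral of the measurable majorant
    [L + m * \1_A]. *)
Lemma upper_expectation_le (d : measure_display) (T : measurableType d) (R : realType)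
    (P : probability T R) (f : T -> \bar R) (A : set T) (L m : R) :
  measurable A -> 0 <= L -> 0 <= m ->
  (forall w, (f w <= (L + m)%:E)%E) -> (forall w, ~ A w -> (f w <= L%:E)%E) ->
  (upper_expectation P f <= L%:E + m%:E * P A)%E.
Proof.
move=> mA L0 m0 fm fL.
pose g w : \bar R := (L%:E + m%:E * (\1_A w)%:E)%E.
have mI : measurable_fun setT (fun w => (\1_A w)%:E : \bar R).
  by apply/measurable_EFinP; exact: measurable_indic.
have mg : measurable_fun setT (fun w => m%:E * (\1_A w)%:E : \bar R)%E.
  exact: measurable_funeM.
have gE : (\int[P]_w g w = L%:E + m%:E * P A)%E.
  rewrite /g ge0_integralD//; last first.
    by move=> w _; rewrite mule_ge0// lee_fin.
  rewrite integral_cst// [X in (_ * X + _)%E](probability_setT P) mule1.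
  rewrite ge0_integralZl ?lee_fin//.
  by rewrite integral_indic// setIT.
rewrite -gE; apply: ereal_inf_lbound; exists g => //; split.
  by apply: emeasurable_funD.
move=> w; rewrite /g indicE; have [Aw|nAw] := pselect (A w).
  by rewrite mem_set// mule1 -EFinD fm.
by rewrite memNset// mule0 adde0 fL.
Qed.

Unset Implicit Arguments.

Theorem theorem1 (R : realType) (D : set (R * R))
  (smoothD : smooth_convex_domain D) (areaD : area D = 1%E)
  (rule : tie_rule R) (ruleP : breaks_ties rule)
  (d : nat -> measure_display) (T : forall n, measurableType (d n))
  (P : forall n, probability (T n) R)
  (X : forall n, 'I_n -> {RV (P n) >-> (R * R)%type})
  (indepX : forall n, mutually_independent (X n))
  (unifX : forall n (i : 'I_n), uniform_on (dilate (Num.sqrt n%:R) D) (X n i)) :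
  let sites n (w : T n) : 'I_n -> R * R := fun i => X n i w in
  let M n (w : T n) (z q : R * R) : \bar R :=
    max_neighbourhoods (range (sites n w)) (rule n (sites n w)) z q in
  forall eps : R, 0 < eps ->
    (\forall n \near \oo,
       (mu_ext (P n)
          [set w | exists z q, [/\ range (sites n w) z,
             dilate (Num.sqrt n%:R) D q &
             ((ln n%:R `^ (3 + eps))%:E < M n w z q)%E]]
        <= (n%:R^-1)%:E)%E)
    /\
    (exists C : R, \forall n \near \oo,
       (upper_expectation (P n)
          (fun w => ereal_sup [set m | exists z q, [/\ range (sites n w) z,
             dilate (Num.sqrt n%:R) D q & m = M n w z q]])
        <= (C * ln n%:R `^ (3 + eps))%:E)%E).
Proof.
move=> sites M eps eps0.
have [mD convD _] := smoothD; have cD := convex_segment_closed convD.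
have [ctr [rho [K [rho0 K0 oD DK]]]] := domain_bounds mD cD areaD.
pose large n := 4 * crowd_rate rho K + 9 <= ln (n%:R : R).
have near_large : \forall n \near \oo, large n by exact: near_ln_ge.
pose bad n := atypical (X n) D rho K.
have mbad n : large n -> measurable (bad n) by exact: measurable_atypical.
have bad_le n : large n -> (P n (bad n) <= (n%:R^-1)%:E)%E.
  by move=> ln_n; exact: (probability_atypical (indepX n) mD rho0 K0 oD DK (unifX n) ln_n).
pose L n : nat := Num.truncn (ln (n%:R : R) ^+ 3).
have Mle n w z q : large n -> ~ bad n w -> range (sites n w) z ->
    dilate (Num.sqrt n%:R) D q -> (M n w z q <= (L n)%:R%:E)%E.
  move=> ln_n typ Sz Eq; apply: max_neighbourhoods_le => //.
    by move=> z' q'; exact: ruleP.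
  move=> p Sp pq.
  exact: (typical_sites_within cD rho0 K0 oD DK ln_n typ Sp Eq pq).
have Mle_n n w z q : range (sites n w) z -> (M n w z q <= n%:R%:E)%E.
  by apply: max_neighbourhoods_le_sites => z' q'; exact: ruleP.
have Lpow n : large n -> 1 <= ln (n%:R : R) `^ (3 + eps) /\
    (L n)%:R <= ln (n%:R : R) `^ (3 + eps).
  move=> ln_n.
  have l1 : 1 <= ln (n%:R : R).
    apply: le_trans ln_n; have : 0 <= crowd_rate rho K.
      by rewrite divr_ge0 ?sqr_ge0// mulr_ge0 ?sqr_ge0// mulr_ge0 ?sqr_ge0.
    lra.
  have l3 : ln (n%:R : R) ^+ 3 <= ln (n%:R : R) `^ (3 + eps).
    rewrite -powR_mulrn; last by lra.
    by rewrite ler_powR// lerDl ltW.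
  split; first by apply: le_trans l3; rewrite exprn_ege1.
  by apply: le_trans l3; rewrite truncn_le exprn_ge0//; lra.
split.
  near=> n.
  have ln_n : large n by near: n.
  apply: le_trans (bad_le _ ln_n); rewrite -measurable_mu_extE; last exact: mbad.
  apply: le_mu_ext => w [z [q [Sz Eq lt]]]; apply: contrapT => typ.
  move: lt; rewrite ltNge => /negP; apply; apply: le_trans (Mle _ _ _ _ ln_n typ Sz Eq) _.
  by rewrite lee_fin; case: (Lpow _ ln_n).
exists 2; near=> n.
have ln_n : large n by near: n.
have [l1 l3] := Lpow _ ln_n.
apply: le_trans (@upper_expectation_le _ _ _ (P n) _ _ _ _ (mbad _ ln_n) (ler0n _ (L n)) (ler0n _ n) _ _) _.
- move=> w; apply: ge_ereal_sup => _ [z [q [Sz Eq ->]]].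
  by apply: le_trans (Mle_n _ _ _ _ Sz) _; rewrite lee_fin lerDr.
- move=> w typ; apply: ge_ereal_sup => _ [z [q [Sz Eq ->]]].
  exact: Mle.
apply: (@le_trans _ _ ((L n)%:R%:E + n%:R%:E * (n%:R^-1)%:E)%E).
  by apply: leeD => //; apply: lee_wpmul2l; [rewrite lee_fin|exact: bad_le].
rewrite -EFinM -EFinD lee_fin.
have : n%:R * n%:R^-1 <= 1 :> R.
  by have [->|n0] := eqVneq (n%:R : R) 0; [rewrite mul0r|rewrite mulfV].
lra.
Unshelve. all: by end_near.
Qed.
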